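(* Let $X$ be a set, $x_1,x_2\in X$, and let $Z$ be a well-ordered set. Each of the following six operated polynomial identities (OPIs) in $\mathbf{k}\mathfrak{S}(X)$, taken individually (i.e. with $\Phi$ the corresponding one-element set), is Gröbner-Shirshov on $Z$ with respect to the monomial order $\leq_{\rm dt}$ on $\mathfrak{S}(Z)$: $$L(x_1 x_2),\quad L(x_1 x_2) - x_1 L(x_2),\quad L(x_1 x_2) - L(x_1) x_2,$$ $$L(x_1 x_2) - x_1 L(x_2) - L(x_1) x_2,\quad L(x_1) x_2,\quad x_1 L(x_2).$$
   Context: Throughout, $\mathbf{k}$ is a unitary commutative ring, algebras are non-unitary associative $\mathbf{k}$-algebras, and $S(Y)$ is the free semigroup on a set $Y$ (nonempty words). **Bracketed words.** For a set $Y$, let $L(Y)=\{L(y)\mid y\in Y\}$ be a disjoint copy of $Y$. For a set $X$ put $\mathfrak{S}_0(X)=S(X)$, $\mathfrak{S}_n(X)=S(X\sqcup L(\mathfrak{S}_{n-1}(X)))$ for $n\ge 1$ (with the natural inclusions $\mathfrak{S}_{n-1}(X)\subseteq\mathfrak{S}_n(X)$), and $\mathfrak{S}(X)=\bigcup_{n\ge0}\mathfrak{S}_n(X)$. It is a semigroup under concatenation with the operator $L:u\mapsto L(u)$; it is the free operated semigroup (semigroup with a self-map) on $X$. $\mathbf{k}\mathfrak{S}(X)$ is the free $\mathbf{k}$-module on $\mathfrak{S}(X)$ with product and operator $L$ extended linearly; it is the free operated algebra on $X$. Write $L^2(u)=L(L(u))$. Every $u\in\mathfrak{S}(X)$ is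 uniquely $u=u_1\cdots u_n$ with $n\ge1$ and $u_i\in X\sqcup L(\mathfrak{S}(X))$ (such $u_i$ are called prime); $|u|=n$ is the breadth of $u$. The depth $\mathrm{dep}(u)$ is the least $n$ with $u\in\mathfrak{S}_n(X)$. **OPIs.** An OPI is an element $\phi(x_1,\ldots,x_k)\in\mathbf{k}\mathfrak{S}(X)$ with $k\geq 1$ and $x_1,\ldots,x_k\in X$ (distinct variables). For $r_1,\dots,r_k\in\mathfrak{S}(Z)$, $\phi(r_1,\dots,r_k)\in\mathbf{k}\mathfrak{S}(Z)$ is obtained by substituting $r_i$ for $x_i$. For a set $\Phi$ of OPIs, $S_\Phi(Z)=\{\phi(r_1,\ldots,r_k)\mid r_1,\ldots,r_k\in\mathfrak{S}(Z),\ \phi(x_1,\dots,x_k)\in\Phi\}$. **Star-words.** $\mathfrak{S}^\star(Z)$ is the set of elements of $\mathfrak{S}(Z\sqcup\{\star\})$ with exactly one occurrence of $\star$. For $q\in\mathfrak{S}^\star(Z)$ and $u\in\mathfrak{S}(Z)$, $q|_u$ is obtained by replacing $\star$ by $u$; for $s=\sum_i c_iu_i\in \mathbf{k}\mathfrak{S}(Z)$, $q|_s=\sum_i c_i\,q|_{u_i}$. **Gröbner-Shirshov bases.** A monomial order on $\mathfrak{S}(Z)$ is a well-order $\le$ such that $u<v$ implies $q|_u<q|_v$ for all $q\in\mathfrak{S}^\star(Z)$. For nonzero $s\in\mathbf{k}\mathfrak{S}(Z)$, $\overline{s}$ is the largest monomial occurring in $s$; $s$ is monic if the coefficient of $\overline{s}$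 is $1$; a set is monic if all its elements are. For monic $f,g$: - if $u,v,w\in\mathfrak{S}(Z)$ satisfy $w=\overline{f}u=v\overline{g}$ and $\max\{|\overline f|,|\overline g|\}<|w|<|\overline f|+|\overline g|$, then $fu-vg$ is an intersection composition of $f,g$ with respect to $w$; - if $w\in\mathfrak{S}(Z)$, $q\in\mathfrak{S}^\star(Z)$ satisfy $w=\overline{f}=q|_{\overline g}$, then $f-q|_g$ is an including composition of $f,g$ with respect to $w$. For monic $S$, an element $h$ is trivial modulo $(S,w)$ if $h=\sum_i c_i\,q_i|_{s_i}$ (finite sum) with $c_i\in\mathbf{k}$, $q_i\in\mathfrak{S}^\star(Z)$, $s_i\in S$ and $\overline{q_i|_{s_i}}<w$. A monic $S\subseteq\mathbf{k}\mathfrak{S}(Z)$ is a Gröbner-Shirshov basis with respect to $\le$ if for all $f,g\in S$ every intersection and every including composition with respect to $w$ is trivial modulo $(S,w)$. A set $\Phi$ of OPIs is Gröbner-Shirshov on $Z$ with respect to $\le$ if $S_\Phi(Z)$ is a Gröbner-Shirshov basis in $\mathbf{k}\mathfrak{S}(Z)$ with respect to $\le$. **The order $\leq_{\rm dt}$.** Let $(Z,\le)$ be well-ordered and let $\deg_Z(u)$ be the number of occurrences in $u$ of elements of $Z$ (with repetition). Let $u=u_1\cdots u_m$, $v=v_1\cdots v_n$ with $u_i,v_j$ prime. Define $u<_{\rm dt}v$ inductively on $\mathrm{dep}(u)+\mathrm{dep}(v)$. If $u,v\in S(Z)$, $u<_{\rm dt}v$ iff $(\deg_Z(u),u_1,\dots,u_m)<(\deg_Z(v),v_1,\dots,v_n)$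 lexicographically. Otherwise: if $u=L(u')$ and $v=L(v')$, $u<_{\rm dt}v$ iff $u'<_{\rm dt}v'$; if $u\in Z$ and $v=L(v')$, $u<_{\rm dt}v$; in the remaining cases, $u<_{\rm dt}v$ iff $(\deg_Z(u),u_1,\dots,u_m)<(\deg_Z(v),v_1,\dots,v_n)$ lexicographically. It is known that $\leq_{\rm dt}$ is a monomial order. *)

(* Defs.v *)
From HB Require Import structures.
From mathcomp Require Import all_boot all_order all_algebra.
From mathcomp Require Import finmap.
From mathcomp.multinomials Require Import monalg.

Set Implicit Arguments.
Unset Strict Implicit.
Unset Printing Implicit Defensive.

Import Order.TTheory GRing.Theory.

Local Open Scope ring_scope.

(* The free semigroup S(Y): the word y1 y2 ... yn (n >= 1) is (y1, [:: y2; ...; yn]). *)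
Definition fsg (Y : Type) : Type := (Y * seq Y)%type.

(* Prime bracketed words: [bprime X] is the disjoint union of X and
   L(fsg (bprime X)).  As an inductive type it is the least solution of this
   equation, i.e. the letters of the union of the stages S_n(X). *)
Inductive bprime (X : Type) : Type :=
  | Var of X
  | Br of fsg (bprime X).

Section BPrimeChoice.
Variable X : Type.

Fixpoint bprime_tree (p : bprime X) : GenTree.tree X :=
  match p with
  | Var x => GenTree.Leaf x
  | Br (q, s) => GenTree.Node 0 (bprime_tree q :: map bprime_tree s)
  end.

Fixpoint tree_bprime (t : GenTree.tree X) : option (bprime X) :=
  match t with
  | GenTree.Leaf x => Some (Var x)
  | GenTree.Node _ s =>
      if pmap tree_bprime s is q :: s' then Some (Br (q, s')) else None
  end.

Lemma bprime_treeK : pcancel bprime_tree tree_bprime.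
Proof.
rewrite /pcancel; fix IH 1; case=> [x|[q s]] //=.
rewrite IH /=; congr (Some (Br (q, _))).
by elim: s => //= p s ->; rewrite IH.
Qed.

End BPrimeChoice.

HB.instance Definition _ (X : eqType) :=
  Equality.copy (bprime X) (pcan_type (@bprime_treeK X)).
HB.instance Definition _ (X : choiceType) :=
  Choice.copy (bprime X) (pcan_type (@bprime_treeK X)).

Definition bword (X : Type) : Type := fsg (bprime X).

HB.instance Definition _ (X : eqType) :=
  Equality.copy (bword X) (bprime X * seq (bprime X))%type.
HB.instance Definition _ (X : choiceType) :=
  Choice.copy (bword X) (bprime X * seq (bprime X))%type.

Section Words.
Variable X : Type.

Definition bprimes (u : bword X) : seq (bprime X) := u.1 :: u.2.
Definition breadth (u : bword X) : nat := size (bprimes u).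
Definition bcat (u v : bword X) : bword X := (u.1, u.2 ++ bprimes v).
Definition bvar (x : X) : bword X := (Var x, [::]).
Definition bL (u : bword X) : bword X := (Br u, [::]).

(* degree in the letters, counted with repetition *)
Fixpoint pdeg (p : bprime X) : nat :=
  match p with
  | Var _ => 1
  | Br (q, s) => (pdeg q + sumn (map pdeg s))%N
  end.
Definition bdeg (u : bword X) : nat := sumn (map pdeg (bprimes u)).

(* number of occurrences of letters satisfying [a] *)
Fixpoint pcount (a : pred X) (p : bprime X) : nat :=
  match p with
  | Var x => a x
  | Br (q, s) => (pcount a q + sumn (map (pcount a) s))%N
  end.
Definition bcount (a : pred X) (u : bword X) : nat :=
  sumn (map (pcount a) (bprimes u)).

End Words.

(* [bsubst f] is the operated semigroup morphism with [bsubst f (bvar y) = f y]. *)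
Section Substitution.
Variables (Y X : Type) (f : Y -> bword X).

Fixpoint psubst (p : bprime Y) : bword X :=
  match p with
  | Var y => f y
  | Br (q, s) => bL (foldl (@bcat X) (psubst q) (map psubst s))
  end.
Definition bsubst (u : bword Y) : bword X :=
  foldl (@bcat X) (psubst u.1) (map psubst u.2).

End Substitution.

(* Star-words: the alphabet Z plus a star is [option Z], with [None] the star. *)
Definition is_star (Z : Type) (o : option Z) : bool := ~~ isSome o.
Definition star_word (Z : Type) (q : bword (option Z)) : bool :=
  bcount (@is_star Z) q == 1%N.
Definition plug (Z : Type) (q : bword (option Z)) (u : bword Z) : bword Z :=
  bsubst (fun o => if o is Some z then bvar z else u) q.

Notation "{ 'opalg' k [ X ] }" := {malg k[bword X]}
  (at level 0, k, X at level 2, format "{ 'opalg'  k [ X ] }").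

Section OperatedAlgebra.
Variable k : comNzRingType.

Definition lin_ext (X Y : choiceType) (h : bword X -> bword Y)
    (s : {opalg k[X]}) : {opalg k[Y]} :=
  \sum_(m <- msupp s) << s@_m *g h m >>.

Definition op_mono (X : choiceType) (u : bword X) : {opalg k[X]} := << u >>.
Definition op_mul (X : choiceType) (f g : {opalg k[X]}) : {opalg k[X]} :=
  \sum_(u <- msupp f) \sum_(v <- msupp g) << f@_u * g@_v *g bcat u v >>.
Definition op_L (X : choiceType) : {opalg k[X]} -> {opalg k[X]} :=
  lin_ext (@bL X).

Definition plug_ext (Z : choiceType) (q : bword (option Z)) :
    {opalg k[Z]} -> {opalg k[Z]} :=
  lin_ext (plug q).

(* S_Phi(Z).  A substitution is given on the whole of X; only its values
   r_1, ..., r_k at the variables x_1, ..., x_k of phi matter. *)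
Definition S_of (X Z : choiceType) (Phi : {opalg k[X]} -> Prop)
    (s : {opalg k[Z]}) : Prop :=
  exists (phi : {opalg k[X]}) (r : X -> bword Z),
    Phi phi /\ s = lin_ext (bsubst r) phi.

Section GroebnerShirshov.
Variables (Z : choiceType) (le : rel (bword Z)).
Implicit Types (s f g h : {opalg k[Z]}) (S : {opalg k[Z]} -> Prop).
Implicit Types (u v w m : bword Z) (q : bword (option Z)).

Definition strict u v : bool := (u != v) && le u v.

(* [m] is the leading monomial of [s]; this forces [s] to be nonzero *)
Definition is_lead s m : Prop :=
  m \in msupp s /\ forall m', m' \in msupp s -> le m' m.

Definition monic s : Prop := exists2 m, is_lead s m & s@_m = 1.

Definition intersection_composition f g w h : Prop :=
  exists fb gb u v,
    [/\ is_lead f fb, is_lead g gb, w = bcat fb u /\ w = bcat v gb,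
        (maxn (breadth fb) (breadth gb) < breadth w < breadth fb + breadth gb)%N
      & h = op_mul f (op_mono u) - op_mul (op_mono v) g].

Definition including_composition f g w h : Prop :=
  exists gb q,
    [/\ is_lead f w, is_lead g gb, star_word q, w = plug q gb
      & h = f - plug_ext q g].

Definition trivial_mod S w h : Prop :=
  exists t : seq (k * bword (option Z) * {opalg k[Z]}),
    (forall c q s, (c, q, s) \in t ->
       [/\ star_word q, S s
         & exists2 m, is_lead (plug_ext q s) m & strict m w])
    /\ h = \sum_(a <- t) a.1.1 *: plug_ext a.1.2 a.2.

Definition GS_basis S : Prop :=
  (forall s, S s -> monic s) /\
  forall f g w h, S f -> S g ->
    intersection_composition f g w h \/ including_composition f g w h ->
    trivial_mod S w h.

Definition GS_on (X : choiceType) (Phi : {opalg k[X]} -> Prop) : Prop :=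
  GS_basis (S_of Phi).

End GroebnerShirshov.
End OperatedAlgebra.

Arguments op_mono k {X} u.

Section OrderDt.
Variables (d : Order.disp_t) (Z : orderType d).

(* Words of equal degree are never proper prefixes of one another, so for the
   use below the two clauses with an empty list are immaterial. *)
Fixpoint lex_lt (T : eqType) (lt : rel T) (s t : seq T) : bool :=
  match s, t with
  | x :: s', y :: t' => lt x y || (x == y) && lex_lt lt s' t'
  | [::], _ :: _ => true
  | _, [::] => false
  end.

(* One step of the recursion: [ltp] compares primes.  A comparison of two
   single primes is delegated to [ltp], the others are degree-lexicographic. *)
Definition dt_step (ltp : rel (bprime Z)) (u v : bword Z) : bool :=
  match u, v with
  | (p, [::]), (q, [::]) => ltp p q
  | _, _ => (bdeg u < bdeg v)%N
            || (bdeg u == bdeg v) && lex_lt ltp (bprimes u) (bprimes v)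
  end.

(* The value of the clause L(u') < z is forced: the degree comparison
   (deg L(u') >= 1 = deg z) can only tie, and then asks again whether L(u') < z;
   it is false since z < L(u'). *)
Fixpoint dt_prime (p q : bprime Z) {struct p} : bool :=
  match p, q with
  | Var a, Var b => (a < b)%O
  | Var _, Br _ => true
  | Br _, Var _ => false
  | Br u, Br v => dt_step dt_prime u v
  end.

Definition lt_dt (u v : bword Z) : bool := dt_step dt_prime u v.
Definition le_dt (u v : bword Z) : bool := (u == v) || lt_dt u v.

End OrderDt.

(* Main.v *)
(* The first four identities are phi_{a,b} = L(xy) - a x L(y) - b L(x) y for
   idempotent coefficients a, b in {0, 1}; the leading word of phi_{a,b}(u, v)
   is L(uv), of breadth 1, so there are no intersection compositions.
   Including compositions are of two kinds.
   - L(uv) = L(u'v') with, say, u = u'c and v' = cv.  Then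
       phi(u'c, v) - phi(u', cv) = a u' phi(c, v) - b phi(u', c) v,
     which is where a^2 = a and b^2 = b are used.
   - L(uv) = L(q|_m) with m = L(u'v') a subword of uv.  Since m is a prime, the
     star-word q splits as q1 q2 with u = q1|_m and v = q2|_m.  Writing
     g = phi(u', v'), m1 = u'L(v') and m2 = L(u')v',
       phi(u, v) - L(q1 q2)|_g = a phi(q1|_m1, q2|_m1) + b phi(q1|_m2, q2|_m2)
                                 - a (q1 L(q2))|_g - b (L(q1) q2)|_g.
   For the last two identities S consists of monomials, and every composition
   is zero. *)
Require Import Defs.
From mathcomp Require Import all_boot all_order all_algebra.
From mathcomp Require Import finmap.
From mathcomp.multinomials Require Import monalg.
From mathcomp Require Import ring.

Import Order.TTheory GRing.Theory.

Local Open Scope ring_scope.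

Set Implicit Arguments.
Unset Strict Implicit.
Unset Printing Implicit Defensive.

(** * Bracketed words: degree, induction and factorizations *)

Section BracketedWords.
Variable X : Type.
Implicit Types (u v w : bword X) (p : bprime X).

Lemma bcatA u v w : bcat u (bcat v w) = bcat (bcat u v) w.
Proof. by rewrite /bcat /bprimes -catA. Qed.

Lemma bdeg_cat u v : bdeg (bcat u v) = (bdeg u + bdeg v)%N.
Proof. by rewrite /bdeg /bcat /bprimes -cat_cons map_cat sumn_cat. Qed.

(** Letters generate all words under [bL] and [bcat]. Since [bprime] is nested in a list, the proof
    recurses on primes by [fix] and on the content of a bracket by an inner [elim]. *)
Lemma bword_ind (P : bword X -> Prop) :
  (forall x, P (bvar x)) -> (forall u, P u -> P (bL u)) ->
  (forall u v, P u -> P v -> P (bcat u v)) -> forall u, P u.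
Proof.
move=> Pvar PL Pcat.
suff Pp : forall p, P (p, [::]).
  case=> p s; elim: s p => [|p' s IHs] p; first exact: Pp.
  exact: (Pcat (p, [::]) (p', s)).
fix IH 1; case=> [x|[p s]]; first exact: Pvar.
apply: PL; elim: s p (IH p) => [//|p' s IHs] p Pp.
by apply: (Pcat (p, [::]) (p', s)) => //; apply: IHs.
Qed.

Lemma bdeg_gt0 u : (0 < bdeg u)%N.
Proof.
elim/bword_ind: u => // [[p s]|u v u_gt0 _]; first by rewrite /bdeg /= addn0.
by rewrite bdeg_cat addn_gt0 u_gt0.
Qed.

Lemma pdeg_gt0 p : (0 < pdeg p)%N.
Proof. by have := bdeg_gt0 (p, [::]); rewrite /bdeg /= addn0. Qed.

(** Levi's lemma for the free semigroup. Words are nonempty, so equal cuts form a case of their own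
    beside the two with a middle word [c]. *)
Lemma bcat_eq u v u' v' : bcat u v = bcat u' v' ->
  [\/ u = u' /\ v = v', exists2 c, u = bcat u' c & v' = bcat c v
    | exists2 c, u' = bcat u c & v = bcat c v'].
Proof.
case: u v u' v' => [p s] [q t] [p' s'] [q' t']; rewrite /bcat /bprimes /=.
case=> <-; elim: s s' => [|x s IHs] [|x' s'] /=.
- by case=> <- <-; constructor 1.
- by case=> -> ->; constructor 3; exists (x', s').
- by case=> <- <-; constructor 2; exists (x, s).
case=> <- /IHs[[[->] [-> ->]]|[[y r] [->] [-> ->]]|[[y r] [->] [-> ->]]].
- by constructor 1.
- by constructor 2; exists (y, r).
- by constructor 3; exists (y, r).
Qed.

End BracketedWords.

Lemma bcount_cat (X : Type) (a : pred X) (u v : bword X) :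
  bcount a (bcat u v) = (bcount a u + bcount a v)%N.
Proof. by rewrite /bcount /bcat /bprimes -cat_cons map_cat sumn_cat. Qed.

Lemma bcount_L (X : Type) (a : pred X) (u : bword X) :
  bcount a (bL u) = bcount a u.
Proof. by case: u => p s; rewrite /bcount /= addn0. Qed.

(** * Substitution as a morphism of operated semigroups *)

Section Substitution.
Variables (Y X : Type).
Implicit Types (f : Y -> bword X) (u v : bword Y).

Lemma foldl_bcat (w w' : bword X) s :
  foldl (@bcat X) (bcat w w') s = bcat w (foldl (@bcat X) w' s).
Proof. by elim: s w' => [//|v s IHs] w' /=; rewrite -bcatA IHs. Qed.

Lemma bsubst_cat f u v : bsubst f (bcat u v) = bcat (bsubst f u) (bsubst f v).
Proof. by rewrite /bsubst /= map_cat foldl_cat /= foldl_bcat. Qed.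

Lemma bsubst_L f u : bsubst f (bL u) = bL (bsubst f u).
Proof. by case: u. Qed.

Lemma bsubst_var f y : bsubst f (bvar y) = f y.
Proof. by []. Qed.

End Substitution.

(** * Star-words and their factorizations *)

Section StarWords.
Variable Z : Type.
Implicit Types (u v w : bword Z) (q : bword (option Z)).

Definition star : bword (option Z) := bvar None.

(** Turns an ordinary word into the star-free factor of a star-word. *)
Definition starless u : bword (option Z) := bsubst (fun z => bvar (Some z)) u.

Lemma bcount_starless u : bcount (@is_star Z) (starless u) = 0%N.
Proof.
elim/bword_ind: u => // [u|u v] IHu; first by rewrite /starless bsubst_L bcount_L.
by move=> IHv; rewrite /starless bsubst_cat bcount_cat IHu IHv.
Qed.

Lemma plug_starless u w : plug (starless u) w = u.
Proof.
elim/bword_ind: u => // [u|u v] IHu.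
  by rewrite /starless /plug !bsubst_L; congr bL.
by move=> IHv; rewrite /starless /plug !bsubst_cat; congr bcat.
Qed.

Lemma plug_cat q1 q2 w : plug (bcat q1 q2) w = bcat (plug q1 w) (plug q2 w).
Proof. exact: bsubst_cat. Qed.

Lemma plug_L q w : plug (bL q) w = bL (plug q w).
Proof. exact: bsubst_L. Qed.

Lemma breadth_bcat u v : breadth (bcat u v) = (breadth u + breadth v)%N.
Proof. by rewrite /breadth /bcat /bprimes -cat_cons size_cat. Qed.

(** The star and [bL u] are both single primes. *)
Lemma plug_L_breadth q u : breadth (plug q (bL u)) = breadth q.
Proof.
elim/bword_ind: q => [[z|]|q|q1 q2] //; first by rewrite plug_L.
by rewrite plug_cat /breadth /bprimes /= !size_cat /= => [[->]] [->].
Qed.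

Lemma plug_L_eq_cat q u v w : plug q (bL w) = bcat u v ->
  exists q1 q2, [/\ q = bcat q1 q2, u = plug q1 (bL w) & v = plug q2 (bL w)].
Proof.
case: q => p s e.
(* The cut of [q] goes after [n + 1] primes, the breadth of [u]; by [lt_ns] a prime remains to the
   right, so the default of [nth] below is never returned. *)
pose n := size u.2.
have lt_ns : (n < size s)%N.
  have := congr1 (@breadth Z) e.
  rewrite plug_L_breadth breadth_bcat /breadth /= addSn => -[->].
  by rewrite addnS ltnS leq_addr.
pose q1 : bword (option Z) := (p, take n s).
pose q2 : bword (option Z) := (nth p s n, drop n.+1 s).
have eq : (p, s) = bcat q1 q2.
  by rewrite /bcat /bprimes /= -drop_nth // cat_take_drop.
have sz : breadth (plug q1 (bL w)) = breadth u.
  by rewrite plug_L_breadth /breadth /= size_take lt_ns.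
(* Equal breadths of the left factors exclude a middle word [c], which would have breadth 0. *)
exists q1, q2; move: e; rewrite eq plug_cat => /bcat_eq[[-> ->]|[c e _]|[c e _]] //.
  by move/eqP: sz; rewrite e breadth_bcat -[X in _ == X]addn0 eqn_add2l.
by move/eqP: sz; rewrite e breadth_bcat -[X in X == _]addn0 eqn_add2l.
Qed.

(** By breadth, [q] is a single prime; it is not a letter of [Z], since it contains the star. *)
Lemma star_word_eq_L q u w : star_word q -> bL u = plug q (bL w) ->
  (q = star /\ u = w) \/
  (exists q', [/\ q = bL q', star_word q' & u = plug q' (bL w)]).
Proof.
move=> st_q e; have: breadth q = 1%N by rewrite -(plug_L_breadth q w) -e.
case: q st_q e => [[[z|]|q'] []] // st_q e _; first by left; case: e => ->.
right; exists q'; split=> //; first by rewrite /star_word -bcount_L.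
by move: e; rewrite -[(_, _)]/(bL q') plug_L => -[].
Qed.

End StarWords.

(** * Lexicographic comparison of sequences *)

Section LexLt.
Variables (T : eqType) (lt : rel T).
Implicit Types s t : seq T.

(** Here and for transitivity the assumption on [lt] is local to the entries of [s], the form in
    which an induction hypothesis on the primes of a word supplies it. *)
Lemma lex_lt_irr s : {in s, forall x, lt x x = false} -> lex_lt lt s s = false.
Proof.
elim: s => //= x s IHs lt_xx; rewrite lt_xx ?mem_head // eqxx /=.
by apply: IHs => y s_y; rewrite lt_xx // in_cons s_y orbT.
Qed.

Lemma lex_lt_trans t s r :
  {in s, forall x y z, lt x y -> lt y z -> lt x z} ->
  lex_lt lt s t -> lex_lt lt t r -> lex_lt lt s r.
Proof.
elim: s t r => [|x s IHs] [|y t] [|z r] //= lt_tr.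
have IH := IHs t r (sub_in1 (fun y s_y => mem_behead (s := x :: s) s_y) lt_tr).
case/orP=> [lt_xy|/andP[/eqP-> lt_st]] /orP[lt_yz|/andP[/eqP<- lt_tr']].
- by rewrite (lt_tr x (mem_head x s) _ _ lt_xy lt_yz).
- by rewrite lt_xy.
- by rewrite lt_yz.
- by rewrite eqxx IH ?orbT.
Qed.

Lemma lex_lt_catl s t t' : lex_lt lt t t' -> lex_lt lt (s ++ t) (s ++ t').
Proof. by move=> lt_tt'; elim: s => //= x s ->; rewrite eqxx orbT. Qed.

(** Appending [t] could reverse the comparison only if [s] were a proper prefix of [s']; positive
    degrees with equal sums forbid this. *)
Lemma lex_lt_catr (deg : T -> nat) s s' t : (forall x, 0 < deg x)%N ->
  sumn (map deg s) = sumn (map deg s') ->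
  lex_lt lt s s' -> lex_lt lt (s ++ t) (s' ++ t).
Proof.
move=> deg_gt0; elim: s s' => [|x s IHs] [|y s'] //=.
  by move=> e; have := deg_gt0 y; rewrite lt0n; case: (deg y) e.
move=> e /orP[->//|/andP[/eqP eq_xy lt_ss']]; move: e; rewrite eq_xy eqxx /=.
by move/addnI/IHs=> ->; rewrite ?orbT.
Qed.

End LexLt.

(** * The order [lt_dt]: strict order, compatibility with plugging, leading words *)

Section OrderDt.
Variables (d : Order.disp_t) (Z : orderType d).
Implicit Types (u v w : bword Z) (p : bprime Z) (q : bword (option Z)).

(** Follows the recursion of [dt_prime], which descends from [Br u] to the primes of [u]. *)
Lemma bprime_word_ind (P : bprime Z -> Prop) :
  (forall x, P (Var x)) -> (forall u, {in bprimes u, forall p, P p} -> P (Br u)) ->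
  forall p, P p.
Proof.
move=> Pvar PBr p.
suff: {in bprimes (p, [::]), forall p, P p} by apply; rewrite mem_head.
move: (p, [::]) => u; elim/bword_ind: u => {p} [x|u IHu|u v IHu IHv] p.
- by rewrite mem_seq1 => /eqP->; apply: Pvar.
- by rewrite mem_seq1 => /eqP->; apply: PBr.
by rewrite /bprimes -cat_cons mem_cat => /orP[/IHu|/IHv].
Qed.

Lemma bdeg1 p : bdeg (p, [::]) = pdeg p.
Proof. by rewrite /bdeg /= addn0. Qed.

Lemma pdeg_Br u : pdeg (Br u) = bdeg u.
Proof. by case: u. Qed.

(** The order on primes refines the degree: a letter has the least possible degree 1, and a bracket
    has the degree of its content, where [dt_step] compares degrees or meets single primes again. *)
Lemma dt_prime_pdeg p p' :
  (dt_prime p p' -> (pdeg p <= pdeg p')%N) /\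
  ((pdeg p < pdeg p')%N -> dt_prime p p').
Proof.
elim/bprime_word_ind: p p' => [x|u IHu] [y|v] //.
- by split=> // _; apply: pdeg_gt0.
- by split=> //; rewrite ltnNge pdeg_gt0.
rewrite !pdeg_Br -[dt_prime _ _]/(dt_step (@dt_prime d Z) u v) /dt_step.
case: u v IHu => [p [|p1 s]] [p' [|p1' s']] IHu.
  by rewrite !bdeg1; apply: IHu (mem_head _ _) _.
all: by split=> [/orP[/ltnW//|/andP[/eqP->//]]|->].
Qed.

(* With the degree compared first, the clause for two single primes of
   [dt_step] is an instance of the degree-lexicographic one. *)
Lemma lt_dtE u v :
  lt_dt u v = (bdeg u < bdeg v)%N
    || (bdeg u == bdeg v) && lex_lt (@dt_prime d Z) (bprimes u) (bprimes v).
Proof.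
rewrite /lt_dt /dt_step; case: u v => [p [|p1 s]] [p' [|p1' s']] //.
rewrite !bdeg1 /= andbF orbF; have [le_pp' lt_pp'] := dt_prime_pdeg p p'.
by case: ltngtP lt_pp' le_pp' => //= [_ ->|] // gt _; case: dt_prime => // /(_ isT).
Qed.

Lemma lt_dt_bdeg u v : (bdeg u < bdeg v)%N -> lt_dt u v.
Proof. by rewrite lt_dtE => ->. Qed.

Lemma dt_prime_irr p : dt_prime p p = false.
Proof.
elim/bprime_word_ind: p => [x|u IHu] /=; first exact: ltxx.
by rewrite -/(lt_dt u u) lt_dtE ltnn eqxx lex_lt_irr.
Qed.

Lemma lt_dt_irr u : lt_dt u u = false.
Proof. exact: (dt_prime_irr (Br u)). Qed.

Lemma dt_prime_trans p p' p'' : dt_prime p p' -> dt_prime p' p'' -> dt_prime p p''.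
Proof.
elim/bprime_word_ind: p p' p'' => [x|u IHu] [y|v] [z|w] //; first exact: lt_trans.
rewrite /= -/(lt_dt u v) -/(lt_dt v w) -/(lt_dt u w) !lt_dtE.
case/orP=> [lt_uv|/andP[/eqP-> uv]] /orP[lt_vw|/andP[/eqP<- vw]].
- by rewrite (ltn_trans lt_uv).
- by rewrite lt_uv.
- by rewrite lt_vw.
- by rewrite eqxx (lex_lt_trans IHu uv vw) orbT.
Qed.

Lemma lt_dt_trans v u w : lt_dt u v -> lt_dt v w -> lt_dt u w.
Proof. exact: (@dt_prime_trans (Br u) (Br v) (Br w)). Qed.

Lemma le_dt_refl u : le_dt u u.
Proof. by rewrite /le_dt eqxx. Qed.

Lemma le_dt_anti u v : le_dt u v -> le_dt v u -> u = v.
Proof.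
case/orP=> [/eqP//|lt_uv] /orP[/eqP//|/(lt_dt_trans lt_uv)].
by rewrite lt_dt_irr.
Qed.

Lemma lt_dt_strict u v : lt_dt u v -> strict (@le_dt d Z) u v.
Proof.
move=> lt_uv; rewrite /strict /le_dt lt_uv orbT andbT.
by apply: contraTneq lt_uv => ->; rewrite lt_dt_irr.
Qed.

Lemma lt_dt_catl w u v : lt_dt u v -> lt_dt (bcat w u) (bcat w v).
Proof.
rewrite !lt_dtE !bdeg_cat ltn_add2l eqn_add2l => /orP[->//|/andP[-> lt_uv]].
by apply/orP; right; apply: (lex_lt_catl (bprimes w) lt_uv).
Qed.

Lemma lt_dt_catr w u v : lt_dt u v -> lt_dt (bcat u w) (bcat v w).
Proof.
rewrite !lt_dtE !bdeg_cat ltn_add2r eqn_add2r => /orP[->//|/andP[deg_uv lt_uv]].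
by rewrite deg_uv (lex_lt_catr (bprimes w) (@pdeg_gt0 Z) (eqP deg_uv) lt_uv) orbT.
Qed.

Lemma lt_dt_plug q u v : star_word q -> lt_dt u v -> lt_dt (plug q u) (plug q v).
Proof.
move=> st_q lt_uv.
(* The induction meets factors without a star, on which both sides agree; all other words are
   compared strictly, however many stars they have. *)
suff: if bcount (@is_star Z) q == 0%N then plug q u == plug q v
      else lt_dt (plug q u) (plug q v).
  by rewrite (eqP st_q).
elim/bword_ind: q {st_q} => [[z|]|q|q1 q2]; rewrite ?plug_L ?bcount_L //.
- exact: eqxx.
- by case: ifP => [_ /eqP->|_ lt_q]; [apply: eqxx|apply: lt_q].
rewrite !plug_cat bcount_cat addn_eq0.
case: (_ == 0%N) => [/eqP->|lt1]; case: (_ == 0%N) => [/eqP->|lt2] //=.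
- exact: lt_dt_catl.
- exact: lt_dt_catr.
exact: lt_dt_trans (lt_dt_catr _ lt1) (lt_dt_catl _ lt2).
Qed.

Lemma bdeg_L u : bdeg (bL u) = bdeg u.
Proof. by rewrite bdeg1 pdeg_Br. Qed.

Lemma lt_dt_cat_L u v : lt_dt (bcat u (bL v)) (bL (bcat u v)).
Proof.
rewrite lt_dtE bdeg_L !bdeg_cat bdeg_L eqxx; apply/orP; right.
(* Degrees tie, so the first primes decide. A letter is below any bracket; a bracket opening the
   left factor has content of degree smaller than that of the whole product. *)
case: u => [[x|u] s] //; apply/orP; left; apply: (@lt_dt_bdeg u).
rewrite bdeg_cat -addn1; apply: leq_add (bdeg_gt0 v).
by rewrite -pdeg_Br leq_addr.
Qed.

Lemma lt_dt_L_cat u v : lt_dt (bcat (bL u) v) (bL (bcat u v)).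
Proof.
rewrite lt_dtE bdeg_L !bdeg_cat bdeg_L eqxx; apply/orP; right.
(* The first primes are the brackets of [u] and of [bcat u v], and [v] has positive degree. *)
apply/orP; left; apply: (@lt_dt_bdeg u).
by rewrite bdeg_cat -[X in (X < _)%N]addn0 ltn_add2l bdeg_gt0.
Qed.

End OrderDt.

(** * Coefficients of monomials and of linear combinations *)

Lemma msupp_mono (k : comNzRingType) (X : choiceType) (u : bword X) :
  msupp (op_mono k u) = [fset u]%fset.
Proof. by rewrite msuppU oner_eq0. Qed.

Lemma mcoeff_mono (k : comNzRingType) (X : choiceType) (u m : bword X) :
  (op_mono k u)@_m = (u == m)%:R.
Proof. exact: mcoeffU. Qed.

Section Combinations.
Variables (k : comNzRingType) (X : choiceType).
Implicit Types (a b c : k) (f g : {opalg k[X]}).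

Lemma mcoeff_comb a b f g m :
  (a *: f + b *: g)@_m = a * f@_m + b * g@_m.
Proof.
rewrite (mcoeffD m (a *: f)).
exact: (congr2 +%R (mcoeffZ a f m) (mcoeffZ b g m)).
Qed.

(* The coefficient functions [F0], ... are passed as arguments because rewriting
   [(trinomial a b m0 m1 m2)@_m] in place makes unification diverge. *)
Lemma sub_eq_comb2 a b f0 f1 g0 g1 (F0 F1 G0 G1 : bword X -> k) :
  (forall m, f0@_m = F0 m) -> (forall m, f1@_m = F1 m) ->
  (forall m, g0@_m = G0 m) -> (forall m, g1@_m = G1 m) ->
  (forall m, F0 m - F1 m = a * G0 m + b * G1 m) ->
  f0 - f1 = a *: g0 + b *: g1.
Proof.
move=> f0E f1E g0E g1E e; apply/malgP=> m.
apply: etrans (mcoeffB m f0 f1) (etrans _ (esym (mcoeff_comb a b g0 g1 m))).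
by rewrite f0E f1E g0E g1E.
Qed.

Lemma sub_eq_comb4 a b a' b' f0 f1 g0 g1 g2 g3
    (F0 F1 G0 G1 G2 G3 : bword X -> k) :
  (forall m, f0@_m = F0 m) -> (forall m, f1@_m = F1 m) ->
  (forall m, g0@_m = G0 m) -> (forall m, g1@_m = G1 m) ->
  (forall m, g2@_m = G2 m) -> (forall m, g3@_m = G3 m) ->
  (forall m, F0 m - F1 m = (a * G0 m + b * G1 m) + (a' * G2 m + b' * G3 m)) ->
  f0 - f1 = (a *: g0 + b *: g1) + (a' *: g2 + b' *: g3).
Proof.
move=> f0E f1E g0E g1E g2E g3E e; apply/malgP=> m.
have comb : (a *: g0 + b *: g1 + (a' *: g2 + b' *: g3))@_m =
    (a * g0@_m + b * g1@_m) + (a' * g2@_m + b' * g3@_m).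
  apply: etrans (mcoeffD m (a *: g0 + b *: g1) _) _.
  by congr (_ + _); apply: mcoeff_comb.
apply: etrans (mcoeffB m f0 f1) (etrans _ (esym comb)).
by rewrite f0E f1E g0E g1E g2E g3E.
Qed.

End Combinations.

(** * Linear extension of maps between words *)

Section LinearExtension.
Variables (k : comNzRingType) (X Y : choiceType) (h : bword X -> bword Y).
Implicit Types f g : {opalg k[X]}.

(** Padding with zero coefficients lets the sums for [f], [g] and [f - g] run over one common
    set. *)
Lemma lin_extEw (D : {fset bword X}) f : (msupp f `<=` D)%fset ->
  lin_ext h f = \sum_(m <- D) << f@_m *g h m >>.
Proof.
move=> le_fD; rewrite /lin_ext; apply: big_fset_incl => // m _ /mcoeff_outdom ->.
exact: monalgU0.
Qed.

Lemma lin_extB f g : lin_ext h (f - g) = lin_ext h f - lin_ext h g.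
Proof.
rewrite (lin_extEw (msuppB_le f g)) (lin_extEw (fsubsetUl _ (msupp g))).
rewrite (lin_extEw (fsubsetUr (msupp f) _)) -sumrB.
by apply: eq_bigr => m _; rewrite mcoeffB monalgUB.
Qed.

Lemma lin_extZ c f : lin_ext h (c *: f) = c *: lin_ext h f.
Proof.
rewrite (lin_extEw (msuppZ_le c f)) /lin_ext scaler_sumr.
by apply: eq_bigr => m _; apply/malgP=> w; rewrite !(mcoeffZ, mcoeffU) mulrnAr.
Qed.

Lemma lin_ext_mono m : lin_ext h (op_mono k m) = op_mono k (h m).
Proof. by rewrite /lin_ext msupp_mono big_seq_fset1 mcoeffUU. Qed.

End LinearExtension.

Lemma op_mul_mono (k : comNzRingType) (X : choiceType) (u v : bword X) :
  op_mul (op_mono k u) (op_mono k v) = op_mono k (bcat u v).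
Proof.
by rewrite /op_mul !msupp_mono !big_seq_fset1 !mcoeffUU mulr1.
Qed.

(** * Trinomials with leading coefficient 1 *)

Section Trinomials.
Variables (k : comNzRingType) (X : choiceType).

(** The three words are arbitrary, so that plugging into a star-word keeps the shape. *)
Definition trinomial (a b : k) (m0 m1 m2 : bword X) : {opalg k[X]} :=
  op_mono k m0 - a *: op_mono k m1 - b *: op_mono k m2.

Lemma lin_ext_comb (Y : choiceType) (h : bword X -> bword Y) a b f0 f1 f2 :
  lin_ext h (f0 - a *: f1 - b *: f2 : {opalg k[X]}) =
  lin_ext h f0 - a *: lin_ext h f1 - b *: lin_ext h f2.
Proof.
rewrite (lin_extB h (f0 - a *: f1) (b *: f2)) (lin_extB h f0 (a *: f1)).
exact: (congr2 (fun g1 g2 => lin_ext h f0 - g1 - g2)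
          (lin_extZ h a f1) (lin_extZ h b f2)).
Qed.

Lemma lin_ext_trinomial (Y : choiceType) (h : bword X -> bword Y) a b m0 m1 m2 :
  lin_ext h (trinomial a b m0 m1 m2) =
  op_mono k (h m0) - a *: op_mono k (h m1) - b *: op_mono k (h m2).
Proof.
have comb (f0 f1 f2 g0 g1 g2 : {opalg k[Y]}) : f0 = g0 -> f1 = g1 -> f2 = g2 ->
    f0 - a *: f1 - b *: f2 = g0 - a *: g1 - b *: g2 by move=> -> -> ->.
exact: etrans (lin_ext_comb h a b _ _ _) (comb _ _ _ _ _ _
  (lin_ext_mono k h m0) (lin_ext_mono k h m1) (lin_ext_mono k h m2)).
Qed.

Lemma mcoeff_trinomial a b m0 m1 m2 m :
  (trinomial a b m0 m1 m2)@_m =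
  (m0 == m)%:R - a * (m1 == m)%:R - b * (m2 == m)%:R.
Proof.
have comb (f0 f1 f2 : {opalg k[X]}) :
    (f0 - a *: f1 - b *: f2)@_m = f0@_m - a * f1@_m - b * f2@_m.
  rewrite (mcoeffB m (f0 - a *: f1)) (mcoeffB m f0).
  exact: (congr2 (fun c1 c2 => f0@_m - c1 - c2) (mcoeffZ a f1 m) (mcoeffZ b f2 m)).
by rewrite comb; congr (_ - _ * _ - _ * _); apply: mcoeff_mono.
Qed.

End Trinomials.

(** * Closure properties of triviality modulo [S] and [w] *)

Section TrivialMod.
Variables (k : comNzRingType) (Z : choiceType) (le : rel (bword Z)).
Variables (S : {opalg k[Z]} -> Prop) (w : bword Z).

Lemma trivial_mod0 : trivial_mod le S w 0.
Proof. by exists [::]; rewrite big_nil. Qed.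

Lemma trivial_modD g h :
  trivial_mod le S w g -> trivial_mod le S w h -> trivial_mod le S w (g + h).
Proof.
move=> [s [Ss ->]] [t [St ->]]; exists (s ++ t); rewrite big_cat; split=> //.
by move=> c q f; rewrite mem_cat => /orP[/Ss|/St].
Qed.

Lemma trivial_modZ c g : trivial_mod le S w g -> trivial_mod le S w (c *: g).
Proof.
move=> [t [St ->]]; exists [seq (c * x.1.1, x.1.2, x.2) | x <- t].
split=> [c' q f /mapP[[[c1 q1] f1] /St H [_ -> ->]]//|].
by rewrite big_map scaler_sumr; apply: eq_bigr => x _; rewrite scalerA.
Qed.

Lemma trivial_mod_plug q s m : star_word q -> S s ->
  is_lead le (plug_ext q s) m -> strict le m w ->
  trivial_mod le S w (plug_ext q s).
Proof.
move=> st_q Ss lead_m lt_mw; exists [:: (1, q, s)].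
split; last by rewrite big_seq1 scale1r.
by move=> c q' s'; rewrite inE => /eqP[_ -> ->]; split=> //; exists m.
Qed.

End TrivialMod.

(** * Leading words of trinomials *)

Section LeadingTrinomials.
Variables (k : comNzRingType) (d : Order.disp_t) (Z : orderType d).
Implicit Types (u v w m : bword Z) (q : bword (option Z)) (a b : k).

Notation le := (@le_dt d Z).

Lemma is_lead_uniq (f : {opalg k[Z]}) m m' :
  is_lead le f m -> is_lead le f m' -> m = m'.
Proof.
move=> [f_m le_m] [f_m' le_m'].
by apply: le_dt_anti; [apply: le_m'|apply: le_m].
Qed.

Lemma is_lead_mono m : is_lead le (op_mono k m) m.
Proof.
by split=> [|m']; rewrite msupp_mono in_fset1 // => /eqP->; apply: le_dt_refl.
Qed.

(** Both lower words differ from [m0], so no choice of [a] and [b] can alter its coefficient. *)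
Lemma trinomial_coef_lead a b m0 m1 m2 : lt_dt m1 m0 -> lt_dt m2 m0 ->
  (trinomial a b m0 m1 m2)@_m0 = 1.
Proof.
move=> lt1 lt2; rewrite mcoeff_trinomial eqxx.
have [/eqP/negPf-> /eqP/negPf->] : m1 <> m0 /\ m2 <> m0.
  by split=> e; move: lt1 lt2; rewrite e lt_dt_irr.
by rewrite !mulr0 !subr0.
Qed.

Lemma is_lead_trinomial a b m0 m1 m2 : lt_dt m1 m0 -> lt_dt m2 m0 ->
  is_lead le (trinomial a b m0 m1 m2) m0.
Proof.
move=> lt1 lt2; split=> [|m].
  by rewrite -mcoeff_neq0 trinomial_coef_lead // oner_eq0.
rewrite -mcoeff_neq0 mcoeff_trinomial.
have [<-|_] := eqVneq m0 m; first by rewrite le_dt_refl.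
have [<-|_] := eqVneq m1 m; first by rewrite /le_dt lt1 orbT.
have [<-|_] := eqVneq m2 m; first by rewrite /le_dt lt2 orbT.
by rewrite !mulr0 !subr0 eqxx.
Qed.

Lemma plug_ext_trinomial q a b m0 m1 m2 :
  plug_ext q (trinomial a b m0 m1 m2) =
  trinomial a b (plug q m0) (plug q m1) (plug q m2).
Proof. exact: lin_ext_trinomial. Qed.

Definition phi a b u v : {opalg k[Z]} :=
  trinomial a b (bL (bcat u v)) (bcat u (bL v)) (bcat (bL u) v).

Lemma is_lead_phi a b u v : is_lead le (phi a b u v) (bL (bcat u v)).
Proof. by apply: is_lead_trinomial; [apply: lt_dt_cat_L|apply: lt_dt_L_cat]. Qed.

(** * Compositions within the family [phi] *)

Section Basis.
Variables (a b : k) (S : {opalg k[Z]} -> Prop).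
Hypothesis S_phi : forall s, S s <-> exists u v, s = phi a b u v.
Hypotheses (aa : a * a = a) (bb : b * b = b).

(** Plugging preserves [lt_dt], hence the leading word, so triviality reduces to one comparison with
    [w]. *)
Lemma trivial_plug_phi q u v w : star_word q ->
  lt_dt (plug q (bL (bcat u v))) w ->
  trivial_mod le S w (plug_ext q (phi a b u v)).
Proof.
move=> st_q lt_w.
apply: (@trivial_mod_plug _ _ _ _ _ _ _ (plug q (bL (bcat u v)))) => //.
- by apply/S_phi; exists u, v.
- rewrite plug_ext_trinomial.
  apply: is_lead_trinomial; apply: lt_dt_plug => //; first exact: lt_dt_cat_L.
  exact: lt_dt_L_cat.
- exact: lt_dt_strict.
Qed.

Lemma trivial_phi u v w : lt_dt (bL (bcat u v)) w -> trivial_mod le S w (phi a b u v).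
Proof.
move=> lt_w; have := @trivial_plug_phi (star Z) u v w isT lt_w.
by rewrite plug_ext_trinomial.
Qed.

Lemma trivial_overlap u v c :
  trivial_mod le S (bL (bcat u (bcat c v)))
    (phi a b (bcat u c) v - phi a b u (bcat c v)).
Proof.
set w := bL _.
(* The two multiples of [phi] used here have leading words [u L(cv)] and [L(uc) v], both below
   [L(ucv)]. *)
have Hl : trivial_mod le S w (plug_ext (bcat (starless u) (star Z)) (phi a b c v)).
  apply: trivial_plug_phi.
    by rewrite /star_word bcount_cat bcount_starless.
  by rewrite plug_cat plug_starless; apply: lt_dt_cat_L.
have Hr : trivial_mod le S w (plug_ext (bcat (star Z) (starless v)) (phi a b u c)).
  apply: trivial_plug_phi.
    by rewrite /star_word bcount_cat bcount_starless.
  by rewrite plug_cat plug_starless /w bcatA; apply: lt_dt_L_cat.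
suff -> : phi a b (bcat u c) v - phi a b u (bcat c v) =
    a *: plug_ext (bcat (starless u) (star Z)) (phi a b c v)
    + (- b) *: plug_ext (bcat (star Z) (starless v)) (phi a b u c).
  by apply: trivial_modD; apply: trivial_modZ.
rewrite !plug_ext_trinomial !plug_cat !plug_starless /plug !bsubst_var /phi !bcatA.
apply: (sub_eq_comb2 (mcoeff_trinomial _ _ _ _ _) (mcoeff_trinomial _ _ _ _ _)
          (mcoeff_trinomial _ _ _ _ _) (mcoeff_trinomial _ _ _ _ _)) => m.
cbv beta.
(* The [ab] terms at [u L(c) v] cancel; idempotence of [a] settles [u c L(v)], that of [b] settles
   [L(u) c v]. *)
ring: aa bb.
Qed.

Lemma trivial_nested q1 q2 u v : let g := phi a b u v in
  star_word (bcat q1 q2) ->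
  let w := bL (plug (bcat q1 q2) (bL (bcat u v))) in
  trivial_mod le S w
    (phi a b (plug q1 (bL (bcat u v))) (plug q2 (bL (bcat u v)))
     - plug_ext (bL (bcat q1 q2)) g).
Proof.
move=> g st_q w.
pose m0 := bL (bcat u v); pose m1 := bcat u (bL v); pose m2 := bcat (bL u) v.
(* The star lies in exactly one of [q1], [q2]; replacing [m0] by a smaller [m] there lowers the
   leading word below [w]. *)
have H m : lt_dt m m0 -> trivial_mod le S w (phi a b (plug q1 m) (plug q2 m)).
  by move=> lt_m; apply: trivial_phi; rewrite -plug_cat; apply: lt_dt_plug lt_m.
have H1 := H m1 (lt_dt_cat_L u v); have H2 := H m2 (lt_dt_L_cat u v).
have Hl : trivial_mod le S w (plug_ext (bcat q1 (bL q2)) g).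
  apply: trivial_plug_phi.
    by rewrite /star_word bcount_cat bcount_L -bcount_cat.
  by rewrite /w !plug_cat plug_L; apply: lt_dt_cat_L.
have Hr : trivial_mod le S w (plug_ext (bcat (bL q1) q2) g).
  apply: trivial_plug_phi.
    by rewrite /star_word bcount_cat bcount_L -bcount_cat.
  by rewrite /w !plug_cat plug_L; apply: lt_dt_L_cat.
suff -> : phi a b (plug q1 m0) (plug q2 m0) - plug_ext (bL (bcat q1 q2)) g =
    (a *: phi a b (plug q1 m1) (plug q2 m1) + b *: phi a b (plug q1 m2) (plug q2 m2))
    + ((- a) *: plug_ext (bcat q1 (bL q2)) g + (- b) *: plug_ext (bcat (bL q1) q2) g).
  by apply: trivial_modD; apply: trivial_modD; apply: trivial_modZ.
rewrite !plug_ext_trinomial !(plug_cat, plug_L) -/m0 -/m1 -/m2 /phi.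
apply: (sub_eq_comb4 (mcoeff_trinomial _ _ _ _ _) (mcoeff_trinomial _ _ _ _ _)
          (mcoeff_trinomial _ _ _ _ _) (mcoeff_trinomial _ _ _ _ _)
          (mcoeff_trinomial _ _ _ _ _) (mcoeff_trinomial _ _ _ _ _)) => m.
cbv beta.
(* Terms carrying a product of two coefficients cancel in pairs. *)
ring.
Qed.

Lemma GS_basis_phi : GS_basis le S.
Proof.
split=> [s /S_phi[u [v ->]]|f g w h /S_phi[u [v ->]] /S_phi[u' [v' ->]]].
  exists (bL (bcat u v)); first exact: is_lead_phi.
  by apply: trinomial_coef_lead; [apply: lt_dt_cat_L|apply: lt_dt_L_cat].
have leadE u1 v1 m : is_lead le (phi a b u1 v1) m -> m = bL (bcat u1 v1).
  by move=> lead_m; apply: is_lead_uniq lead_m (is_lead_phi a b u1 v1).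
case=> [[fb [gb [x [y [/leadE-> /leadE-> _]]]]]|[gb [q [/leadE-> /leadE->]]]].
  (* Both leading words have breadth 1, so [w] would have breadth strictly between 1 and 2. *)
  by case/andP=> /leq_ltn_trans lt2 /lt2.
move=> st_q /(star_word_eq_L st_q)[[-> e] ->|[q' [-> st_q' e] ->]].
  rewrite -[plug_ext _ _]/(plug_ext (star Z) _) plug_ext_trinomial.
  rewrite -[trinomial _ _ _ _ _]/(phi a b u' v').
  case/bcat_eq: e => [[-> ->]|[c -> ->]|[c -> ->]].
  - by rewrite subrr; apply: trivial_mod0.
  - by rewrite -bcatA; apply: trivial_overlap.
  (* The overlap with the two elements exchanged, hence the opposite composition. *)
  - rewrite -opprB -scaleN1r; apply: trivial_modZ; apply: trivial_overlap.
have [q1 [q2 [eq_q -> ->]]] := plug_L_eq_cat (esym e).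
by rewrite eq_q in st_q' *; rewrite -plug_cat; apply: trivial_nested.
Qed.

End Basis.

(** Both terms of a composition of two monomials are the monomial [w]. *)
Lemma GS_basis_mono (S : {opalg k[Z]} -> Prop) :
  (forall s, S s -> exists m, s = op_mono k m) -> GS_basis le S.
Proof.
move=> S_mono; split=> [s /S_mono[m ->]|f g w h /S_mono[mf ->] /S_mono[mg ->]].
  by exists m; [apply: is_lead_mono | rewrite mcoeff_mono eqxx].
have leadE m m' : is_lead le (op_mono k m) m' -> m' = m.
  by move=> lead_m'; apply: is_lead_uniq lead_m' (is_lead_mono m).
suff h0 : intersection_composition le (op_mono k mf) (op_mono k mg) w h \/
    including_composition le (op_mono k mf) (op_mono k mg) w h -> h = 0.
  by move/h0=> ->; apply: trivial_mod0.
case=> [[fb [gb [u [v [/leadE-> /leadE-> [-> e] _ ->]]]]]|].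
  by rewrite !op_mul_mono -e subrr.
move=> [gb [q [/leadE-> /leadE-> _ e ->]]].
by rewrite /plug_ext lin_ext_mono -e subrr.
Qed.

End LeadingTrinomials.

(** * From identities to their sets of substitution instances *)

Section Generators.
Variables (k : comNzRingType) (X : choiceType) (x1 x2 : X).
Variables (d : Order.disp_t) (Z : orderType d).

Lemma S_of1 (f : {opalg k[X]}) (s : {opalg k[Z]}) :
  S_of (fun p => p = f) s <-> exists r, s = lin_ext (bsubst r) f.
Proof.
by split=> [[p [r [-> ->]]]|[r ->]]; [exists r|exists f, r].
Qed.

(** Instances of a monomial are monomials; this covers the first identity and the last two. *)
Lemma GS_on_mono (m : bword X) :
  GS_on (@le_dt d Z) (fun p : {opalg k[X]} => p = op_mono k m).
Proof.
apply: GS_basis_mono => s /S_of1[r ->]; exists (bsubst r m).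
exact: lin_ext_mono.
Qed.

Lemma GS_on_trinomial (hx : x1 != x2) (a b : k) : a * a = a -> b * b = b ->
  GS_on (@le_dt d Z) (fun p : {opalg k[X]} => p =
    trinomial a b (bL (bcat (bvar x1) (bvar x2)))
      (bcat (bvar x1) (bL (bvar x2))) (bcat (bL (bvar x1)) (bvar x2))).
Proof.
move=> aa bb; apply: (GS_basis_phi _ aa bb) => s; apply: iff_trans (S_of1 _ _) _.
have substE r : lin_ext (bsubst r)
    (trinomial a b (bL (bcat (bvar x1) (bvar x2)))
      (bcat (bvar x1) (bL (bvar x2))) (bcat (bL (bvar x1)) (bvar x2)))
    = phi a b (r x1) (r x2) :> {opalg k[Z]}.
  exact: lin_ext_trinomial.
split=> [[r ->]|[u [v ->]]]; first by exists (r x1), (r x2).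
(* As [x1] and [x2] are distinct, their values can be prescribed independently. *)
exists (fun x => if x == x1 then u else v).
by rewrite substE eqxx eq_sym (negPf hx).
Qed.

End Generators.

Lemma op_L_mono (k : comNzRingType) (X : choiceType) (u : bword X) :
  op_L (op_mono k u) = op_mono k (bL u).
Proof. exact: lin_ext_mono. Qed.

Theorem theorem3p2 (k : comNzRingType) (X : choiceType) (x1 x2 : X)
    (hx : x1 != x2) (d : Order.disp_t) (Z : orderType d)
    (hZ : well_founded (fun a b : Z => (a < b)%O)) :
  let L := @op_L k X in
  let mul := @op_mul k X in
  let y1 := op_mono k (bvar x1) in
  let y2 := op_mono k (bvar x2) in
  let is_GS (phi : {opalg k[X]}) := GS_on (@le_dt d Z) (fun p => p = phi) in
  is_GS (L (mul y1 y2)) /\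
  is_GS (L (mul y1 y2) - mul y1 (L y2)) /\
  is_GS (L (mul y1 y2) - mul (L y1) y2) /\
  is_GS (L (mul y1 y2) - mul y1 (L y2) - mul (L y1) y2) /\
  is_GS (mul (L y1) y2) /\
  is_GS (mul y1 (L y2)).
Proof.
move=> L mul y1 y2 is_GS.
pose m0 := bL (bcat (bvar x1) (bvar x2)).
pose m1 := bcat (bvar x1) (bL (bvar x2)).
pose m2 := bcat (bL (bvar x1)) (bvar x2).
have e0 : L (mul y1 y2) = op_mono k m0 by rewrite /mul op_mul_mono; apply: op_L_mono.
have e1 : mul y1 (L y2) = op_mono k m1 by rewrite /L op_L_mono; apply: op_mul_mono.
have e2 : mul (L y1) y2 = op_mono k m2 by rewrite /L op_L_mono; apply: op_mul_mono.
rewrite e0 e1 e2.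
(* The pairs [(1, 0)], [(0, 1)], [(1, 1)] for [(a, b)] give the second, third and fourth
   identities. *)
have GS_trinomial := @GS_on_trinomial k X x1 x2 d Z hx.
have c1 : (1 : k) * 1 = 1 := mulr1 1.
have c0 : (0 : k) * 0 = 0 := mulr0 0.
split; first exact: GS_on_mono.
split.
  have := GS_trinomial 1 0 c1 c0.
  by rewrite /trinomial scale1r scale0r subr0.
split.
  have := GS_trinomial 0 1 c0 c1.
  by rewrite /trinomial scale1r scale0r subr0.
split.
  have := GS_trinomial 1 1 c1 c1.
  have -> : trinomial 1 1 m0 m1 m2 = op_mono k m0 - op_mono k m1 - op_mono k m2 :=
    congr2 (fun f1 f2 => op_mono k m0 - f1 - f2) (scale1r _) (scale1r _).
  exact.
by split; apply: GS_on_mono.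
Qed.
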